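(* Let $\mathcal{H}$ be a real Hilbert space, let $A\colon \mathcal{H}\rightrightarrows\mathcal{H}$ and $B\colon\mathcal{H}\rightrightarrows\mathcal{H}$ be maximally monotone operators with $\operatorname{zer}(A+B)\neq\varnothing$, let $\lambda>0$ and let $x_0\in\mathcal{H}$. Let $x,y\colon[0,+\infty)\to\mathcal{H}$ be trajectories generated by the system $$\dot{x}(t)+x(t)=J_{\lambda A}\bigl(x(t)-y(t)\bigr)-\dot{y}(t),\qquad y(t)\in\lambda B(x(t)),$$ with initial condition $x(0)=x_0$. Then there exist $\bar{x},\bar{y}\in\mathcal{H}$ such that: (i) $x(t)$ converges weakly to $\bar{x}$ as $t\to+\infty$, and $\bar{x}\in\operatorname{zer}(A+B)$; (ii) $y(t)$ converges weakly to $\bar{y}$ as $t\to+\infty$, and $\bar{y}\in\lambda B(\bar{x})\cap(-\lambda A(\bar{x}))$.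
   Context: For a set-valued operator $M\colon\mathcal{H}\rightrightarrows\mathcal{H}$, $\operatorname{zer}(M)=\{x\in\mathcal{H}: 0\in M(x)\}$, and $J_M=(\mathrm{Id}+M)^{-1}$ denotes its resolvent, which is single-valued with full domain when $M$ is maximally monotone. ''Trajectories generated by the system'' means that $x,y$ are locally absolutely continuous on $[0,+\infty)$, that the differential equation holds for almost every $t\ge 0$, and that the inclusion $y(t)\in\lambda B(x(t))$ holds for every $t\geq 0$ (so in particular $x_0$ lies in the domain of $B$). Equivalently, $x(t)=J_{\lambda B}(z(t))$ and $y(t)=z(t)-x(t)$, where $z$ is a solution of $\dot{z}(t)=J_{\lambda A}\bigl(2J_{\lambda B}(z(t))-z(t)\bigr)-J_{\lambda B}(z(t))$. *)

(* Defs.v *)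
From HB Require Import structures.
From mathcomp Require Import all_boot all_order all_algebra sesquilinear.
From mathcomp Require Import all_classical all_reals all_analysis.

Set Implicit Arguments.
Unset Strict Implicit.
Unset Printing Implicit Defensive.
Import Order.TTheory GRing.Theory Num.Theory.
Import numFieldNormedType.Exports.
Local Open Scope classical_set_scope.
Local Open Scope ring_scope.

(* The inner product of a real Hilbert space is a positive definite symmetric
   bilinear form [dot : {dot H for idfun}] inducing the norm of a complete
   normed module [H]. *)
Definition induces_norm (R : realType) (H : normedModType R)
    (dot : {dot H for (@idfun R)}) : Prop :=
  forall u : H, `|u| = Num.sqrt (dot u u).

Section SetValuedOperators.
Context (R : realType) (H : normedModType R).

Definition operator := H -> set H.

Definition op_id : operator := fun x => [set x].

Definition op_add (M N : operator) : operator :=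
  fun x => [set u + v | u in M x & v in N x].

Definition op_scale (a : R) (M : operator) : operator :=
  fun x => [set a *: u | u in M x].

Definition op_inv (M : operator) : operator := fun u => [set x | M x u].

Definition zer (M : operator) : set H := [set x | M x 0].

(* [(Id + M)^-1] as a function: [get] picks the unique element of
   [(Id + M)^-1 z]; existence and uniqueness hold for maximally monotone [M]. *)
Definition resolvent (M : operator) : H -> H :=
  fun z => get (op_inv (op_add op_id M) z).

Definition monotone_op (dot : H -> H -> R) (M : operator) : Prop :=
  forall x y u v : H, M x u -> M y v -> 0 <= dot (x - y) (u - v).

Definition maximally_monotone (dot : H -> H -> R) (M : operator) : Prop :=
  monotone_op dot M /\
  forall N : operator,
    monotone_op dot N -> (forall x, M x `<=` N x) -> N = M.

End SetValuedOperators.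

Section Trajectories.
Context (R : realType) (H : normedModType R).

Definition absolutely_continuous (a b : R) (f : R -> H) : Prop :=
  forall e : R, 0 < e -> exists2 d : R, 0 < d &
    forall (n : nat) (s t : 'I_n -> R),
      (forall i, [/\ a <= s i, s i <= t i & t i <= b]) ->
      trivIset setT (fun i => [set` `]s i, t i[]) ->
      \sum_(i < n) (t i - s i) < d ->
      \sum_(i < n) `|f (t i) - f (s i)| < e.

(* Functions on [0, +oo) are represented by total functions on [R] whose values
   at negative arguments are irrelevant. *)
Definition locally_absolutely_continuous (f : R -> H) : Prop :=
  forall T : R, 0 < T -> absolutely_continuous 0 T f.

Definition trajectory (A B : operator H) (lambda : R) (x0 : H)
    (x y : R -> H) : Prop :=
  [/\ locally_absolutely_continuous x,
      locally_absolutely_continuous y,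
      {ae lebesgue_measure, forall t : R, 0 <= t ->
        [/\ derivable x t 1, derivable y t 1 &
            'D_1 x t + x t =
              resolvent (op_scale lambda A) (x t - y t) - 'D_1 y t]},
      (forall t : R, 0 <= t -> op_scale lambda B (x t) (y t)) &
      x 0 = x0].

Definition weakly_converges (dot : H -> H -> R) (f : R -> H) (l : H) : Prop :=
  forall v : H, dot (f t) v @[t --> +oo] --> dot l v.

End Trajectories.

(* Main.v *)
Require Import Defs.
From HB Require Import structures.
From mathcomp Require Import all_boot all_order all_algebra sesquilinear.
From mathcomp Require Import all_classical all_reals all_analysis.
From mathcomp Require Import ring lra.

Set Implicit Arguments.
Unset Strict Implicit.
Unset Printing Implicit Defensive.
Import Order.TTheory GRing.Theory Num.Theory.
Import numFieldNormedType.Exports.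
Local Open Scope classical_set_scope.
Local Open Scope ring_scope.

(** Absorb [lambda] into the operators, and put [z = x + y] and
    [g = J_A (x - y) - x], so that [z' = g] almost everywhere.  By definition of
    the resolvent, [y] lies in [B x] and [- y - g] lies in [A (x + g)]: the pair
    [(x, y)] solves the system [y] in [B x], [- y] in [A x] up to the
    perturbation [g].

    Adding the monotonicity inequalities of [A] and [B] for two perturbed
    solutions gives [<g1 - g2, z1 - z2> <= - |g1 - g2|^2]
    ([perturbed_sol_firm]).  Compared with an exact solution [(p, q)] this says
    that [|z - (p + q)|^2] decreases at rate at least [2 |g|^2] ([fejer]);
    compared along the curve it says that [g] is Lipschitz in time.  A Lipschitz
    velocity that does not tend to zero would consume a fixed amount of
    [|z - (p + q)|^2] infinitely often, hence [g] tends to [0]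
    ([velocity_cvg0]).

    The curves [x] and [y] are bounded, so they have weak limits along every
    ultrafilter that refines the neighbourhoods of [+oo].  Resolvents are not
    weakly continuous, so the limit of [x] cannot be read off from that of [z].
    Instead one passes to the limit in the sum of the two monotonicity
    inequalities, in which the only term that is not weakly continuous,
    [<x, y>], cancels: every pair of weak limits is an exact solution
    ([perturbed_sol_demiclosed]).  As the distance of [z] to [p + q] has a limit
    for every exact solution [(p, q)], Opial's argument shows that all these
    pairs have the same sum, and monotonicity of [B] recovers the pair from its
    sum ([exact_sol_sum_inj]).  All ultrafilters thus give the same limit, which
    is therefore the weak limit at [+oo].

    Three classical facts are established on the way.  Minty's theorem
    ([minty]), which puts the resolvent in the graph, and the Riesz
    representation theorem ([riesz]), which produces weak limits, both come from
    one minimization of a quadratic function over a closed convex set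
    ([quad_minimizer]).  The comparison of an absolutely continuous function
    with an almost everywhere bound on its derivative ([ac_derive_le]) is what
    turns the differential equation into inequalities. *)

(** * Inner products *)
Section InnerProduct.
Context (R : realType) (H : normedModType R) (dot : {dot H for (@idfun R)}).
Context (dot_norm : induces_norm dot).

Lemma dotC u v : dot u v = dot v u.
Proof. by rewrite hermC expr0 mul1r. Qed.

Lemma dotDl u v w : dot (u + v) w = dot u w + dot v w.
Proof. exact: linearDl. Qed.

Lemma dotDr u v w : dot w (u + v) = dot w u + dot w v.
Proof. exact: linearDr. Qed.

Lemma dotNl u v : dot (- u) v = - dot u v.
Proof. exact: linearNl. Qed.

Lemma dotNr u v : dot u (- v) = - dot u v.
Proof. exact: linearNr. Qed.

Lemma dotZl a u v : dot (a *: u) v = a * dot u v.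
Proof. exact: linearZl_LR. Qed.

Lemma dotZr a u v : dot u (a *: v) = a * dot u v.
Proof. exact: linearZr_LR. Qed.

Lemma dot0l u : dot 0 u = 0.
Proof. exact: linear0l. Qed.

Lemma dot0r u : dot u 0 = 0.
Proof. exact: linear0r. Qed.

Definition dotE := (dotDl, dotDr, dotNl, dotNr, dotZl, dotZr, dot0l, dot0r).

Lemma dotuu u : dot u u = `|u| ^+ 2.
Proof.
rewrite dot_norm sqr_sqrtr//.
have [->|u0] := eqVneq u 0; first by rewrite dot0l.
by apply/ltW/neq0_dnorm_gt0.
Qed.

Lemma dot_ge0 u : 0 <= dot u u.
Proof. by rewrite dotuu sqr_ge0. Qed.

(** The square of the vector [<v, v> u - <u, v> v] is nonnegative. *)
Lemma cauchy_schwarz u v : `|dot u v| <= `|u| * `|v|.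
Proof.
have [->|v0] := eqVneq v 0; first by rewrite dot0r !normr0 mulr0.
have v_gt0 : 0 < dot v v by rewrite dotuu exprn_gt0// normr_gt0.
have := dot_ge0 (dot v v *: u - dot u v *: v).
have -> : dot (dot v v *: u - dot u v *: v) (dot v v *: u - dot u v *: v) =
  dot v v * (dot u u * dot v v - dot u v ^+ 2).
  by rewrite !dotE (dotC v u); ring.
rewrite pmulr_rge0// subr_ge0 !dotuu -exprMn.
by move=> uv; rewrite -ler_sqr ?nnegrE ?mulr_ge0// real_normK ?num_real.
Qed.

Lemma cvg_lipschitz (f : H -> R) (C : R) :
  (forall u v, `|f u - f v| <= C * `|u - v|) ->
  forall T (F : set_system T) (FF : Filter F) (g : T -> H) l,
  g x @[x --> F] --> l -> f (g x) @[x --> F] --> f l.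
Proof.
move=> fC T F FF g l gl; apply/cvgrPdist_le => e e0.
have C0 : 0 < `|C| + 1 by rewrite ltr_pwDr.
have d0 : 0 < e / (`|C| + 1) by rewrite divr_gt0.
move/cvgrPdist_le : gl => /(_ _ d0); apply: filterS => t.
rewrite ler_pdivlMr// => h; rewrite (le_trans (fC _ _))// (le_trans _ h)//.
by rewrite mulrC ler_wpM2l// (le_trans (ler_norm C))// lerDl.
Qed.

(** By polarization the inner product is a combination of squared norms. *)
Lemma cvg_dot T (F : set_system T) (FF : Filter F) (f g : T -> H) a b :
  f x @[x --> F] --> a -> g x @[x --> F] --> b ->
  dot (f x) (g x) @[x --> F] --> dot a b.
Proof.
move=> fa gb.
have polar u v : dot u v =
    (`|u + v| * `|u + v| - `|u - v| * `|u - v|) * 4^-1.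
  by rewrite -!expr2 -!dotuu !dotE (dotC v u); field.
rewrite polar; under eq_fun do rewrite polar.
apply: cvgM; last exact: cvg_cst.
by apply: cvgB; apply: cvgM; apply: cvg_norm; (apply: cvgB || apply: cvgD).
Qed.

End InnerProduct.

(** * Minimizing a strongly convex function over a closed convex set *)
Section QuadraticMinimization.
Context (R : realType) (H : completeNormedModType R).
Context (dot : {dot H for (@idfun R)}).
Context (dot_norm : induces_norm dot).

(** The rate is that of points whose values are within [n.+1^-1] of the infimum
    of a function with unit strong convexity. *)
Lemma cvg_of_sqr_dist (u : nat -> H) :
  (forall m n, `|u m - u n| ^+ 2 <= 4 * (m.+1%:R^-1 + n.+1%:R^-1)) ->
  cvgn u.
Proof.
move=> hu; apply: cauchy_cvg; apply: cauchy_exP => e e0.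
have [N _ hN] : \forall n \near \oo, n.+1%:R^-1 < e ^+ 2 / 8.
  have d0 : 0 < e ^+ 2 / 8 by rewrite divr_gt0// exprn_gt0.
  have /cvgr0Pnorm_lt /(_ _ d0) := @cvg_harmonic R.
  by apply: filterS => n; rewrite ger0_norm// invr_ge0.
exists (u N), N => // n /= Nn; rewrite -ball_normE /=.
have := hN _ Nn; have := hN N (leqnn _) => /= h1 h2.
rewrite -ltr_sqr ?nnegrE ?(ltW e0)//; apply: le_lt_trans (hu _ _) _.
by move: h1 h2; set a := N.+1%:R^-1; set b := n.+1%:R^-1; lra.
Qed.

(** A point [(u, v, r)] stands for a point [(u, v)] of the Hilbert space [H * H]
    and a value [r] in the epigraph of a convex function.  Minimizing
    [f + |.|^2 / 2] in this form makes sense of functions [f] with infinite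
    values.  The norm of the product [H * H] is not Hilbertian, which is why the
    two components are kept apart. *)
Definition quad (p : H * H * R) := p.2 + (`|p.1.1| ^+ 2 + `|p.1.2| ^+ 2) / 2.

Lemma quad_mix (s : R) p q :
  quad (s *: p.1 + (1 - s) *: q.1, s * p.2 + (1 - s) * q.2) =
  s * quad p + (1 - s) * quad q -
  s * (1 - s) / 2 * (`|p.1.1 - q.1.1| ^+ 2 + `|p.1.2 - q.1.2| ^+ 2).
Proof.
case: p q => [[u v] r] [[u' v'] r'].
rewrite /quad /= -!(dotuu dot_norm) !dotE (dotC dot u' u) (dotC dot v' v).
by field.
Qed.

Definition convex_comb_closed (D : set (H * H * R)) := forall p q (s : R),
  0 <= s <= 1 -> D p -> D q ->
  D (s *: p.1 + (1 - s) *: q.1, s * p.2 + (1 - s) * q.2).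

(** By [quad_mix] at a midpoint, two points whose values are close to the
    infimum are close to each other, so a minimizing sequence is Cauchy.  The
    conclusion is the first-order optimality condition at the minimizer. *)
Lemma quad_minimizer (D : set (H * H * R)) (c : R) :
  convex_comb_closed D -> closed D -> D !=set0 ->
  (forall p, D p -> c <= quad p) ->
  exists2 p, D p & forall q, D q ->
    p.2 + dot p.1.1 p.1.1 + dot p.1.2 p.1.2 <=
    q.2 + dot p.1.1 q.1.1 + dot p.1.2 q.1.2.
Proof.
move=> Dconv Dcl [d0 Dd0] Dge.
set m := inf (quad @` D).
have hi : has_inf (quad @` D).
  split; first by exists (quad d0), d0.
  by exists c => _ [p Dp <-]; exact: Dge.
have m_le p : D p -> m <= quad p.
  by move=> Dp; apply: ge_inf; [case: hi|exists p].
have [p hp] : {p : nat -> H * H * R &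
    forall n, D (p n) /\ quad (p n) < m + n.+1%:R^-1}.
  apply: (@choice _ _ (fun n q => D q /\ quad q < m + n.+1%:R^-1)) => n.
  have [_ [q Dq <-] ?] : exists2 y, (quad @` D) y & y < m + n.+1%:R^-1.
    by apply: inf_adherent => //; rewrite invr_gt0.
  by exists q.
have hd n k : `|(p n).1.1 - (p k).1.1| ^+ 2 + `|(p n).1.2 - (p k).1.2| ^+ 2 <=
    4 * (n.+1%:R^-1 + k.+1%:R^-1).
  have [[Dn hn] [Dk hk]] := (hp n, hp k).
  have s01 : 0 <= (2^-1 : R) <= 1 by apply/andP; split; lra.
  have := m_le _ (Dconv _ _ _ s01 Dn Dk).
  rewrite quad_mix; move: hn hk; set a := n.+1%:R^-1; set b := k.+1%:R^-1.
  set P := quad (p n); set Q := quad (p k); set X := _ + _ ^+ 2.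
  lra.
have cu : cvgn (fun n => (p n).1.1).
  apply: cvg_of_sqr_dist => n k; apply: le_trans (hd n k).
  by rewrite lerDl sqr_ge0.
have cv : cvgn (fun n => (p n).1.2).
  apply: cvg_of_sqr_dist => n k; apply: le_trans (hd n k).
  by rewrite lerDr sqr_ge0.
have cq : quad (p n) @[n --> \oo] --> m.
  apply: (@squeeze_cvgr _ _ _ _ (fun=> m) (fun n => m + n.+1%:R^-1)).
  - by apply: nearW => n; have [Dn hn] := hp n; rewrite m_le// ltW.
  - exact: cvg_cst.
  - rewrite -[X in _ --> X]addr0.
    by apply: cvgD; [exact: cvg_cst|exact: cvg_harmonic].
set u := limn (fun n => (p n).1.1) in cu *.
set v := limn (fun n => (p n).1.2) in cv *.
pose r := m - (`|u| ^+ 2 + `|v| ^+ 2) / 2.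
have cr : (p n).2 @[n --> \oo] --> r.
  rewrite (_ : (fun n => (p n).2) = fun n => quad (p n) -
      (`|(p n).1.1| ^+ 2 + `|(p n).1.2| ^+ 2) / 2); last first.
    by apply/funext => n; rewrite /quad addrK.
  apply: cvgB => //; apply: cvgM; last exact: cvg_cst.
  by apply: cvgD; rewrite expr2; under eq_fun do rewrite expr2;
    apply: cvgM; apply: cvg_norm.
have Dp : D (u, v, r).
  apply: (@closed_cvg _ _ \oo _ p D Dcl) => //.
    by apply: nearW => n; exact: (hp n).1.
  rewrite (_ : p = fun n => ((p n).1.1, (p n).1.2, (p n).2)); last first.
    by apply/funext => n; case: (p n) => [[]].
  exact: cvg_pair (cvg_pair cu cv) cr.
have qp : quad (u, v, r) = m by rewrite /quad /= subrK.
exists (u, v, r) => // -[[u' v'] r'] Dq /=.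
set k := (`|u' - u| ^+ 2 + `|v' - v| ^+ 2) / 2.
have k0 : 0 <= k by rewrite divr_ge0// addr_ge0 ?sqr_ge0.
set t := r' + dot u u' + dot v v' - (r + dot u u + dot v v).
rewrite -subr_ge0 -/t leNgt; apply/negP => t0.
have kt : 0 < k - t by lra.
(* At the fraction [s] of the segment from the minimizer to [(u', v', r')],
   [quad] exceeds its minimum by [s * (t + s * k)]; for [t < 0] this [s] makes
   the excess negative. *)
set s := - t / (k - t).
have s01 : 0 <= s <= 1.
  apply/andP; split; first by apply: divr_ge0; lra.
  by rewrite ler_pdivrMr//; lra.
have s0 : 0 < s by rewrite divr_gt0// oppr_gt0.
have := m_le _ (Dconv _ _ _ s01 Dq Dp); rewrite -qp.
have -> : quad (s *: (u', v', r').1 + (1 - s) *: (u, v, r).1,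
     s * (u', v', r').2 + (1 - s) * (u, v, r).2) =
     quad (u, v, r) + s * (t + s * k).
  rewrite quad_mix /quad /t /k -!(dotuu dot_norm) /= !dotE.
  by rewrite (dotC dot u' u) (dotC dot v' v); field.
rewrite lerDl pmulr_rge0// (_ : t + s * k = - t ^+ 2 / (k - t)); last first.
  by rewrite /s; field; lra.
rewrite leNgt => /negP; apply.
by rewrite mulNr oppr_lt0 divr_gt0// expr2 nmulr_rgt0.
Qed.

End QuadraticMinimization.

(** * The Riesz and Minty theorems *)
Section RieszMinty.
Context (R : realType) (H : completeNormedModType R).
Context (dot : {dot H for (@idfun R)}).
Context (dot_norm : induces_norm dot).

Lemma closed_epigraph (f : H * H -> R) :
  continuous f -> closed [set p : H * H * R | f p.1 <= p.2].
Proof.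
move=> cf.
rewrite (_ : [set p | _] = (fun p => p.2 - f p.1) @^-1` [set r | 0 <= r]).
  apply: closed_comp; last exact: closed_ge.
  move=> p _; apply: cvgB; first exact: cvg_snd.
  exact: (cvg_comp _ _ (@cvg_fst _ _ (nbhs p.1) (nbhs p.2) _) (cf p.1)).
by apply/seteqP; split=> p /=; rewrite subr_ge0.
Qed.

(** Minimizing [L u + (|u|^2 + |v|^2) / 2] gives a [u] with
    [L w + <u, w> >= 0] for all [w], hence with equality, as [- w] is
    allowed too. *)
Lemma riesz (L : H -> R) (C : R) :
  (forall a u v, L (a *: u + v) = a * L u + L v) ->
  (forall u, `|L u| <= C * `|u|) ->
  exists l, forall v, L v = dot l v.
Proof.
move=> Llin Lbd.
have LB u v : L (u - v) = L u - L v.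
  by rewrite addrC -scaleN1r Llin mulN1r addrC.
have L0 : L 0 = 0 by rewrite -(subrr 0) LB subrr.
have LZ a u : L (a *: u) = a * L u by rewrite -[a *: u]addr0 Llin L0 addr0.
have cL : continuous (fun p : H * H => L p.1).
  move=> p; apply: (cvg_lipschitz (f := L) (C := C)); last exact: cvg_fst.
  by move=> u v; rewrite -LB; exact: Lbd.
have Lmix s u v : L (s *: u + (1 - s) *: v) = s * L u + (1 - s) * L v.
  by rewrite Llin LZ.
pose D := [set p : H * H * R | L p.1.1 <= p.2].
have [[[u v] r]] : exists2 p, D p & forall q, D q ->
    p.2 + dot p.1.1 p.1.1 + dot p.1.2 p.1.2 <=
    q.2 + dot p.1.1 q.1.1 + dot p.1.2 q.1.2.
  apply: (quad_minimizer dot_norm (c := - C ^+ 2 / 2)).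
  - move=> p q s /andP[s0 s1]; rewrite /D /= => Dp Dq; rewrite Lmix.
    by apply: lerD; apply: ler_wpM2l => //; rewrite subr_ge0.
  - exact: closed_epigraph cL.
  - by exists (0, 0, L 0); rewrite /D /=.
  - move=> [[u v] r]; rewrite /D /quad /= => Lr.
    have := Lbd u; rewrite ler_norml => /andP[h _].
    have : 0 <= (`|u| - C) ^+ 2 by exact: sqr_ge0.
    have : 0 <= `|v| ^+ 2 by exact: sqr_ge0.
    by move: h Lr; set a := `|u|; set b := `|v|; set l := L u; nra.
rewrite /D /= => Lur opt.
have key w : 0 <= L w + dot u w.
  have : D (u + w, v, r + L w).
    by rewrite /D /= -[u]scale1r Llin mul1r lerD2r.
  by move=> /opt /=; rewrite dotDr; lra.
exists (- u) => w; rewrite dotNl.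
have := key (- w); rewrite dotNr -[- w]scaleN1r LZ.
by have := key w; lra.
Qed.

Definition monotonically_related (M : operator H) x u :=
  forall y v, M y v -> 0 <= dot (x - y) (u - v).

(** Otherwise [(x, u)] could be added to the graph of [M]. *)
Lemma max_monotone_mem (M : operator H) x u :
  maximally_monotone dot M -> monotonically_related M x u -> M x u.
Proof.
move=> [monoM maxM] rel.
pose N : operator H := fun y => M y `|` [set v | y = x /\ v = u].
suff <- : N = M by right.
apply: maxM => [y y' v v'|y v]; last by left.
move=> [My|[-> ->]] [My'|[-> ->]]; [exact: monoM|..|].
- by have := rel _ _ My; rewrite -[y - x]opprB -[v - u]opprB dotNl dotNr opprK.
- exact: rel.
- by rewrite subrr dot0l.
Qed.

(** The set [D] below is the epigraph of the Fitzpatrick function of [M], the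
    supremum of the affine functions [fitz ab].  It lies above the duality
    product [<x, u>] because [M] is maximal, and agrees with it on the graph of
    [M].  At the minimizer [(u, v)] of this function plus [|.|^2 / 2], the
    optimality condition tested on the graph says that [(- v, - u)] is
    monotonically related to [M], hence in its graph; tested at [(- v, - u)]
    itself it then forces [u = - v]. *)
Lemma minty_zero (M : operator H) : monotone_op dot M ->
  (forall x u, monotonically_related M x u -> M x u) -> exists w, M w (- w).
Proof.
move=> monoM maxM.
(* An empty graph would be related to every point. *)
have [[a0 b0] /= M0] : exists ab : H * H, M ab.1 ab.2.
  apply: contrapT => noM; apply: (noM); exists (0, 0); apply: maxM => y v Myv.
  by exfalso; apply: noM; exists (y, v).
pose G := [set ab : H * H | M ab.1 ab.2].
pose fitz (ab p : H * H) := dot p.1 ab.2 + dot p.2 ab.1 - dot ab.1 ab.2.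
pose D := \bigcap_(ab in G) [set p : H * H * R | fitz ab p.1 <= p.2].
have DM a b : M a b -> D (a, b, dot a b).
  move=> Mab [a' b'] /= Mab'; rewrite /fitz /=.
  by have := monoM _ _ _ _ Mab Mab'; rewrite !dotE (dotC dot b a'); lra.
have Dge p : D p -> dot p.1.1 p.1.2 <= p.2.
  case: p => [[x u] r] /= Dp; rewrite leNgt; apply/negP => rlt.
  have Mxu : M x u.
    apply: maxM => y v Myv; have := Dp (y, v) Myv.
    by rewrite /fitz /= !dotE (dotC dot u y); lra.
  by have := Dp (x, u) Mxu; rewrite /fitz /= (dotC dot u x); lra.
have [[[u v] r] Dp opt] : exists2 p, D p & forall q, D q ->
    p.2 + dot p.1.1 p.1.1 + dot p.1.2 p.1.2 <=
    q.2 + dot p.1.1 q.1.1 + dot p.1.2 q.1.2.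
  apply: (quad_minimizer dot_norm (c := 0)).
  - move=> p q s /andP[s0 s1] Dp Dq ab Gab; have := Dp _ Gab; have := Dq _ Gab.
    rewrite /fitz /= => hq hp; apply: (@le_trans _ _
       (s * fitz ab p.1 + (1 - s) * fitz ab q.1)).
      by rewrite /fitz !dotE le_eqVlt; apply/orP; left; apply/eqP; ring.
    by apply: lerD; apply: ler_wpM2l => //; rewrite subr_ge0.
  - apply: closed_bigI => -[a b] _; apply: closed_epigraph => p.
    apply: cvgB; last exact: cvg_cst.
    by apply: cvgD; apply: (cvg_dot dot_norm);
      (exact: cvg_fst || exact: cvg_snd || exact: cvg_cst).
  - by exists (a0, b0, dot a0 b0); exact: DM.
  - move=> p /Dge; have := dot_ge0 dot_norm (p.1.1 + p.1.2).
    by rewrite /quad -!(dotuu dot_norm) !dotE (dotC dot p.1.2 p.1.1); lra.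
have := Dge _ Dp; rewrite /= in opt * => uvr.
have Mvu : M (- v) (- u).
  apply: maxM => a b /DM /opt /=.
  have := dot_ge0 dot_norm (u + v); rewrite !dotE (dotC dot v u) (dotC dot a u).
  by lra.
have := opt _ (DM _ _ Mvu); rewrite /= !dotE (dotC dot v u) => h.
suff uv : u = - v by exists u; rewrite {1}uv.
apply/eqP; rewrite -addr_eq0 -normr_eq0.
have : `|u + v| ^+ 2 = 0.
  apply/eqP; rewrite eq_le sqr_ge0 andbT -(dotuu dot_norm) !dotE (dotC dot v u).
  by lra.
by move/eqP; rewrite expf_eq0.
Qed.

(** The operator [a |-> M a - z] is maximally monotone when [M] is. *)
Lemma minty (M : operator H) (z : H) :
  maximally_monotone dot M -> exists w, M w (z - w).
Proof.
move=> maxM; pose N : operator H := fun a => [set b | M a (b + z)].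
have [x y u v|x u rel|w] := @minty_zero N.
- move=> Mx My; have := maxM.1 _ _ _ _ Mx My.
  by rewrite opprD addrACA subrr addr0.
- apply: max_monotone_mem maxM _ => y v Myv.
  have := rel y (v - z); rewrite /N /= subrK => /(_ Myv).
  by rewrite opprB addrA.
- by rewrite /N /= addrC; exists w.
Qed.

Lemma max_monotone_scale (M : operator H) (a : R) : 0 < a ->
  maximally_monotone dot M -> maximally_monotone dot (op_scale a M).
Proof.
move=> a0 maxM; split.
  move=> x y _ _ [u Mxu <-] [v Myv <-]; rewrite -scalerBr dotZr.
  by rewrite mulr_ge0 ?(ltW a0)//; exact: maxM.1.
move=> N monoN MN; apply/funext => x.
apply/seteqP; split=> [u Nxu|]; last exact: MN.
exists (a^-1 *: u); last by rewrite scalerA divff ?gt_eqF// scale1r.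
apply: max_monotone_mem maxM _ => y v Myv.
have Nyv : N y (a *: v) by apply: MN; exists v.
rewrite -(pmulr_rge0 _ a0) -dotZr scalerBr scalerA divff ?gt_eqF// scale1r.
exact: monoN.
Qed.

Lemma resolventP (M : operator H) (z : H) : maximally_monotone dot M ->
  M (resolvent M z) (z - resolvent M z).
Proof.
move=> /minty -/(_ z)[w Mw].
have : op_inv (op_add (@op_id R H) M) z (resolvent M z).
  apply: getPex; exists w.
  by exists w => //; exists (z - w) => //; rewrite addrC subrK.
by move=> [_ -> [v Mv zE]]; rewrite -{2}zE addrC addKr.
Qed.

End RieszMinty.

(** * Weak limits along ultrafilters *)
Section Ultralimits.

Lemma fmap_ultra (T V : Type) (f : T -> V) (U : set_system T) :
  UltraFilter U -> UltraFilter (f @ U).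
Proof.
move=> UU; split; first exact: fmap_proper_filter.
move=> G GG sub; apply/seteqP; split=> // A GA; rewrite /= /fmap /=.
have [//|UnA] := in_ultra_setVsetC (f @^-1` A) UU.
have /(filterI GA) : G (~` A) by apply: sub.
by rewrite setICr => /filter_not_empty.
Qed.

(** If a neighbourhood of [l] were not reached along [F], its complement would
    generate with [F] a proper filter, contained in some ultrafilter. *)
Lemma cvg_ultra (T : Type) (V : topologicalType) (F : set_system T)
    (f : T -> V) (l : V) : ProperFilter F ->
  (forall U, UltraFilter U -> F `<=` U -> f x @[x --> U] --> l) ->
  f x @[x --> F] --> l.
Proof.
move=> FF cvgU A Al; apply: contrapT => nFA.
have GG : ProperFilter (within (~` (f @^-1` A)) F).
  apply: Build_ProperFilter; rewrite /within /= => F0; apply: nFA.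
  apply: filterS F0 => t /= h.
  exact: contrapT.
have [U [UU GU]] := ultraFilterLemma GG.
have FU : F `<=` U.
  by move=> B FB; apply: GU; rewrite /within /=; apply: filterS FB => t Bt _.
have UA : U (f @^-1` A) by exact: (cvgU U UU FU _ Al).
have UnA : U (~` (f @^-1` A)).
  by apply: GU; rewrite /within /=; exact: filterE.
apply: (@filter_not_empty _ U); rewrite -(setICr (f @^-1` A)).
exact: filterI.
Qed.

Lemma bounded_ultra_cvg (R : realType) (T : Type) (U : set_system T)
    (f : T -> R) (C : R) : UltraFilter U ->
  (\forall t \near U, `|f t| <= C) -> exists l : R, f t @[t --> U] --> l.
Proof.
move=> UU fC; have := @segment_compact R (- C) C; rewrite compact_ultra.
move=> /(_ (f @ U) (fmap_ultra f UU)) [|l [_ fl]]; last by exists l.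
rewrite /fmap /=; apply: filterS fC => t.
by rewrite ler_norml /= in_itv.
Qed.

Context (R : realType) (H : completeNormedModType R).
Context (dot : {dot H for (@idfun R)}).
Context (dot_norm : induces_norm dot).

(** The scalar limits of [dot (f t) v] depend linearly and boundedly on [v], so
    the Riesz theorem represents them. *)
Lemma bounded_weak_ultra_cvg (T : Type) (U : set_system T) (f : T -> H)
    (C : R) : UltraFilter U -> (\forall t \near U, `|f t| <= C) ->
  exists l, forall v, dot (f t) v @[t --> U] --> dot l v.
Proof.
move=> UU fC.
have [L hL] : {L : H -> R & forall v, dot (f t) v @[t --> U] --> L v}.
  apply: (@choice _ _ (fun v (l : R) => dot (f t) v @[t --> U] --> l)) => v.
  apply: (bounded_ultra_cvg (C := C * `|v|)).
  apply: filterS fC => t ftC; apply: le_trans (cauchy_schwarz dot_norm _ _) _.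
  exact: ler_wpM2r.
have [l Ll] : exists l, forall v, L v = dot l v.
  apply: (riesz dot_norm (C := C)) => [a u v|u].
    have lin : dot (f t) (a *: u + v) @[t --> U] --> a * L u + L v.
      under eq_fun do rewrite dotDr dotZr.
      by apply: cvgD; [apply: cvgM; [exact: cvg_cst|exact: hL]|exact: hL].
    exact: (@cvg_unique R (@norm_hausdorff _ _) _ _ _ _ (hL _) lin).
  apply: cvgr_to_le (cvg_norm (hL u)) _.
  apply: filterS fC => t ftC; apply: le_trans (cauchy_schwarz dot_norm _ _) _.
  exact: ler_wpM2r.
by exists l => v; rewrite -Ll.
Qed.

End Ultralimits.

(** * Absolutely continuous functions and their derivatives *)
Section AbsolutelyContinuous.
Context (R : realType).
Local Notation mu := (@lebesgue_measure R).

Lemma derive_straddle (f : R -> R) (t d e : R) :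
  is_derive t 1 f d -> 0 < e ->
  exists2 r, 0 < r & forall s, `|s - t| < r ->
    `|f s - f t - d * (s - t)| <= e * `|s - t|.
Proof.
move=> [df <-] e0.
move/cvgrPdist_le : (df) => /(_ _ e0) [r /= r0 hr]; exists r => // s st.
have [->|nst] := eqVneq s t; first by rewrite !subrr mulr0 subr0 normr0 mulr0.
have st0 : s - t != 0 by rewrite subr_eq0.
have := hr (s - t); rewrite /= sub0r normrN => /(_ st st0).
rewrite /derive /= [_ *: 1]mulr1 subrK -/(derive f t 1) => h.
rewrite -(divfK st0 (f s - f t)) -mulrBl normrM ler_wpM2r// distrC.
by rewrite mulrC.
Qed.

Lemma measure_disjoint_itv (U : set R) (n : nat) (u v : 'I_n -> R) :
  measurable U -> (forall i, u i <= v i) ->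
  (forall i, [set` `]u i, v i[] `<=` U) ->
  trivIset setT (fun i => [set` `]u i, v i[]) ->
  ((\sum_(i < n) (v i - u i))%:E <= mu U)%E.
Proof.
move=> mU uv uvU tuv.
have mI i : measurable [set` `]u i, v i[] by exact: measurable_itv.
have -> : (\sum_(i < n) (v i - u i))%:E =
    mu (\big[setU/set0]_(i < n) [set` `]u i, v i[]).
  rewrite measure_bigsetU_ord// -sumEFin; apply: eq_bigr => i _.
  rewrite [RHS]lebesgue_measure_itv/= lte_fin.
  by move: (uv i); rewrite le_eqVlt => /predU1P[->|->//]; rewrite ltxx subrr.
apply: le_measure; rewrite ?inE//; first exact: bigsetU_measurable.
apply: (big_ind (fun A => A `<=` U)) => // A B AU BU.
by rewrite subUset.
Qed.

(** Outer regularity of the Lebesgue measure. *)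
Lemma negligible_open_cover (N : set R) (e : R) : mu.-negligible N -> 0 < e ->
  exists U, [/\ open U, N `<=` U & (mu U < e%:E)%E].
Proof.
move=> [A [mA A0 NA]] e0.
have [|U [oU AU Ue]] := @lebesgue_regularity_outer R A e mA _ e0.
  by rewrite [X in (X < _)%E]A0.
have mU : measurable U by exact: measurable_realfun.open_measurable.
exists U; split=> //; first exact: subset_trans AU.
rewrite -(setDUK AU); apply: le_lt_trans Ue.
apply: le_trans (measureU2 _ _ _) _ => //; first exact: measurableD.
by rewrite [X in (X + _)%E]A0 add0e.
Qed.

(** An induction principle on segments, a form of Cousin's lemma.  The
    supremum of the points reached from [a] can be approached from the left by a
    point of [P], and then passed by a jump over it unless it is [b]. *)
Lemma creeping_induction (P : R -> Prop) (a b : R) : a <= b -> P a ->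
  (forall t, a <= t <= b -> exists2 r, 0 < r & forall s s',
     a <= s -> s <= t <= s' -> s' <= b -> t - s < r -> s' - t < r ->
     P s -> P s') ->
  P b.
Proof.
move=> ab Pa step.
pose S := [set s | a <= s <= b /\ P s].
have Sa : S a by split=> //; rewrite lexx.
have hS : has_sup S by split; [exists a|exists b => s [/andP[]]].
have aS : a <= sup S by apply: ub_le_sup => //; case: hS.
have Sb : sup S <= b by apply: ge_sup => [|s [/andP[]]//]; exists a.
have [|r r0 hr] := step (sup S); first by rewrite aS.
have [s [/andP[as_ sb] Ps] sr] := sup_adherent r0 hS.
have sS : s <= sup S by apply: ub_le_sup; [case: hS|split=> //; rewrite as_].
pose s' := Num.min b (sup S + r / 2).
have Ss' : sup S <= s' by rewrite le_min Sb lerDl divr_ge0// ltW.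
have s'b : s' <= b by rewrite ge_min lexx.
have s'r : s' <= sup S + r / 2 by rewrite ge_min lexx orbT.
have Ps' : P s'.
  by apply: (hr s s') => //; [rewrite sS Ss'|lra|lra].
have : s' <= sup S.
  by apply: ub_le_sup; [case: hS|split=> //; rewrite s'b andbT (le_trans aS)].
rewrite ge_min => /orP[bS|]; last by move=> h; lra.
suff <- : s' = b by [].
by apply/eqP; rewrite eq_le s'b (le_trans bS).
Qed.

(** A chain is the state reached at [s] in the proof of [ac_derive_le].  It
    lists disjoint subintervals of [U], over which nothing is known about the
    derivative of [f]: there the expected growth [c * (v i - u i)] is replaced
    by the variation of [f].  They are indexed by [nat] so that appending one
    does not change the type of the indexing. *)
Section Chains.
Context (f : R -> R) (U : set R) (a c : R).

Definition chain (s : R) n (u v : nat -> R) := [/\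
  forall i, (i < n)%N -> [/\ a <= u i, u i <= v i & v i <= s],
  forall i, (i < n)%N -> [set` `]u i, v i[] `<=` U,
  forall i j, (i < j < n)%N -> v i <= u j &
  f s - f a <= c * (s - a - \sum_(i < n) (v i - u i)) +
               \sum_(i < n) `|f (v i) - f (u i)| ].

Lemma chain_skip s t n u v : s <= t -> f t - f s <= c * (t - s) ->
  chain s n u v -> chain t n u v.
Proof.
move=> st fst [h1 h2 h3 h4]; split=> // [i ni|].
  by have [? ? ?] := h1 i ni; split=> //; exact: le_trans st.
by lra.
Qed.

Lemma chain_add s t n u v : a <= s -> s <= t -> [set` `]s, t[] `<=` U ->
  chain s n u v -> chain t n.+1
    (fun i => if (i < n)%N then u i else s)
    (fun i => if (i < n)%N then v i else t).
Proof.
move=> as_ st stU [h1 h2 h3 h4]; split.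
- move=> i _; case: ifP => [/h1[? ? ?]|_]; split=> //; exact: le_trans st.
- by move=> i _; case: ifP => // /h2.
- move=> i j /andP[ij]; rewrite ltnS leq_eqVlt => /predU1P[jn|jn].
    by rewrite jn ltnn -jn ij; rewrite jn in ij; have [] := h1 i ij.
  by rewrite jn (ltn_trans ij jn) h3// ij.
- rewrite !big_ord_recr /= ltnn.
  under eq_bigr do rewrite ltn_ord.
  under [X in _ <= _ + (X + _)]eq_bigr do rewrite ltn_ord.
  by have := ler_norm (f t - f s); lra.
Qed.

End Chains.

(** Cover the null set of bad times by an open set [U] of small measure.
    Creeping from [a] to [b], step over a good time with the slope [c + e] given
    by the derivative there, and over a time in [U] by a subinterval of [U].
    The latter are disjoint and of small total length, hence contribute little
    by absolute continuity. *)
Lemma ac_derive_le (f : R -> R) (a b c : R) : a <= b ->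
  absolutely_continuous a b f ->
  {ae mu, forall t, a <= t <= b -> exists2 d, is_derive t 1 f d & d <= c} ->
  f b - f a <= c * (b - a).
Proof.
move=> ab acf hN; apply/ler_addgt0Pr => e0 e0_gt0.
(* The total error is at most [e * (b - a)] for the slopes, [e] for the
   variation over the bad intervals, and [e] for leaving their length out of
   [b - a]. *)
pose e := e0 / (3 + (b - a)).
have e_gt0 : 0 < e by rewrite divr_gt0//; lra.
have [r r0 hr] := acf _ e_gt0.
pose r' := Num.min r (e / (`|c + e| + 1)).
have r'0 : 0 < r' by rewrite lt_min r0 divr_gt0// ltr_pwDr.
have [U [oU NU Ur]] := negligible_open_cover hN r'0.
have [n [u [v [h1 h2 h3 h4]]]] : exists n u v, chain f U a (c + e) b n u v.
  apply: (creeping_induction (P := fun s => exists n u v,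
      chain f U a (c + e) s n u v) ab).
    exists 0%N, (fun=> 0), (fun=> 0); split=> //.
    by rewrite !big_ord0 !subrr mulr0 addr0.
  move=> t tab; have [Ut|nUt] := pselect (U t).
    have [d /= d0 hd] := oU t Ut; exists d => //.
    move=> s s' as_ /andP[st ts'] s'b sd s'd [n [u [v uv]]].
    exists n.+1, (fun i => if (i < n)%N then u i else s),
      (fun i => if (i < n)%N then v i else s').
    apply: chain_add uv => //; first exact: le_trans ts'.
    move=> z /=; rewrite in_itv /= => /andP[sz zs']; apply: hd => /=.
    by rewrite ltr_norml; apply/andP; split; lra.
  have [d fd dc] : exists2 d, is_derive t 1 f d & d <= c.
    by apply: contrapT => nd; apply: nUt; apply: NU => /= h; exact/nd/h.
  have [d' d'0 hd] := derive_straddle fd e_gt0; exists d' => //.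
  move=> s s' as_ /andP[st ts'] s'b sd s'd [n [u [v uv]]].
  exists n, u, v; apply: chain_skip uv; first exact: le_trans ts'.
  have := hd s; have := hd s'.
  rewrite ger0_norm ?subr_ge0// => /(_ s'd).
  rewrite ler_norml => /andP[_ k1].
  rewrite distrC ger0_norm ?subr_ge0// => /(_ sd).
  rewrite ler_norml => /andP[k2 _].
  have l1 : d * (s' - t) <= c * (s' - t) by rewrite ler_wpM2r// subr_ge0.
  have l2 : d * (t - s) <= c * (t - s) by rewrite ler_wpM2r// subr_ge0.
  by lra.
set L := \sum_(i < n) (v i - u i) in h4.
set V := \sum_(i < n) `|f (v i) - f (u i)| in h4.
have tI : trivIset setT (fun i : 'I_n => [set` `]u i, v i[]).
  have dis (i j : 'I_n) z : (i < j)%N -> z \in `]u i, v i[ ->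
      z \in `]u j, v j[ -> False.
    move=> ij; rewrite !in_itv /= => /andP[_ zv] /andP[uz _].
    have := h3 i j; rewrite ij ltn_ord => /(_ isT) => vu.
    by have := lt_trans (lt_le_trans zv vu) uz; rewrite ltxx.
  move=> i j _ _ [z /= [zi zj]]; apply/val_inj/eqP.
  by case: ltngtP => // ij; exfalso; [exact: dis zi zj|exact: dis zj zi].
have Lr' : L < r'.
  rewrite -lte_fin; apply: le_lt_trans Ur; apply: measure_disjoint_itv => //.
  - exact: measurable_realfun.open_measurable.
  - by move=> i; have [] := h1 i (ltn_ord i).
  - by move=> i; exact: h2.
have L0 : 0 <= L.
  by apply: sumr_ge0 => i _; rewrite subr_ge0; have [] := h1 i (ltn_ord i).
have Ve : V < e.
  apply: hr tI _; last by apply: lt_le_trans Lr' _; rewrite ge_min lexx.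
  by move=> i; exact: h1.
have cL : `|c + e| * L <= e.
  have : L <= e / (`|c + e| + 1).
    by apply/ltW/(lt_le_trans Lr'); rewrite ge_min lexx orbT.
  rewrite ler_pdivlMr ?ltr_pwDr// mulrC; apply: le_trans.
  by apply: ler_wpM2r => //; rewrite lerDl.
have cL' : - ((c + e) * L) <= e.
  apply: le_trans cL; rewrite -mulNr; apply: ler_wpM2r => //.
  by rewrite -normrN ler_norm.
have ee : e * (3 + (b - a)) = e0 by rewrite /e divfK//; apply: lt0r_neq0; lra.
by lra.
Qed.

End AbsolutelyContinuous.

Section AbsolutelyContinuousCurves.
Context (R : realType) (H : normedModType R).

Lemma ac_subitv (a b a' b' : R) (f : R -> H) : a <= a' -> b' <= b ->
  absolutely_continuous a b f -> absolutely_continuous a' b' f.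
Proof.
move=> aa' bb' acf e /acf[d d0 hd]; exists d => // n s t st.
by apply: hd => i; have [? ? ?] := st i; split=> //; lra.
Qed.

Lemma ac_add (a b : R) (f g : R -> H) : absolutely_continuous a b f ->
  absolutely_continuous a b g -> absolutely_continuous a b (fun t => f t + g t).
Proof.
move=> acf acg e e0; have e20 : 0 < e / 2 by rewrite divr_gt0.
have [d d0 hd] := acf _ e20; have [d' d'0 hd'] := acg _ e20.
exists (Num.min d d') => [|n s t st tI]; first by rewrite lt_min d0.
rewrite lt_min => /andP[/(hd n s t st tI) h /(hd' n s t st tI) h'].
rewrite (splitr e); apply: le_lt_trans (ltrD h h'); rewrite -big_split /=.
by apply: ler_sum => i _; rewrite opprD addrACA ler_normD.
Qed.

Lemma ac_comp (a b K : R) (f : R -> H) (phi : R -> R) :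
  (forall s t, a <= s <= b -> a <= t <= b ->
     `|phi t - phi s| <= K * `|f t - f s|) ->
  absolutely_continuous a b f -> absolutely_continuous a b phi.
Proof.
move=> phif acf e e0; have K0 : 0 < `|K| + 1 by rewrite ltr_pwDr.
have [d d0 hd] := acf _ (divr_gt0 e0 K0).
exists d => // n s t st tI /(hd n s t st tI); rewrite ltr_pdivlMr//.
apply: le_lt_trans; rewrite mulr_suml; apply: ler_sum => i _.
have [? ? ?] := st i.
apply: le_trans (phif _ _ _ _) _; [by apply/andP; split; lra..|].
rewrite mulrC; apply: ler_wpM2l => //.
by apply: le_trans (ler_norm K) _; rewrite lerDl.
Qed.

Lemma ac_unif (a b e : R) (f : R -> H) : absolutely_continuous a b f -> 0 < e ->
  exists2 d, 0 < d & forall s t, a <= s -> s <= t -> t <= b -> t - s < d ->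
    `|f t - f s| < e.
Proof.
move=> acf /acf[d d0 hd]; exists d => // s t as_ st tb std.
have := hd 1%N (fun=> s) (fun=> t); rewrite !big_ord1; apply=> //.
by move=> i j _ _ _; rewrite !ord1.
Qed.

(** On an interval shorter than the modulus of continuity for [1], the norm
    grows by at most [1]. *)
Lemma ac_bounded (a b : R) (f : R -> H) :
  a <= b -> absolutely_continuous a b f ->
  exists C, forall t, a <= t <= b -> `|f t| <= C.
Proof.
move=> ab acf; have [d d0 hd] := ac_unif acf (@ltr01 R).
apply: (creeping_induction (P := fun s =>
   exists C, forall t, a <= t <= s -> `|f t| <= C) ab).
  by exists `|f a| => t ta; have /eqP -> : a == t by rewrite eq_le.
move=> t tab; exists (d / 2); first by rewrite divr_gt0.
move=> s s' as_ /andP[st ts'] s'b sd s'd [C hC].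
exists (C + 1) => r /andP[ar rs'].
have hCs : `|f s| <= C by apply: hC; rewrite as_ lexx.
have [rs|sr] := leP r s; first by have := hC r; rewrite ar rs => /(_ isT); lra.
have := hd s r as_ (ltW sr); have -> : r <= b by lra.
have -> : r - s < d by lra.
move=> /(_ isT isT) h.
by have := ler_normD (f r - f s) (f s); rewrite subrK; lra.
Qed.

End AbsolutelyContinuousCurves.

Section RealLimits.
Context (R : realType).

(** The lower bound by the limit [m] is kept because [velocity_cvg0] compares a
    late value of [phi] with [m]. *)
Lemma nonincreasing_cvg_pinfty (phi : R -> R) (c : R) :
  (forall s t, 0 <= s -> s <= t -> phi t <= phi s) ->
  (forall t, 0 <= t -> c <= phi t) ->
  exists m, (forall t, 0 <= t -> m <= phi t) /\ phi t @[t --> +oo] --> m.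
Proof.
move=> phid phic; pose S := phi @` [set t | 0 <= t].
have hS : has_inf S.
  split; last by exists c => _ [t t0 <-]; exact: phic.
  by exists (phi 0); apply: imageP; rewrite /= lexx.
have mS t : 0 <= t -> inf S <= phi t.
  by move=> t0; apply: ge_inf; [case: hS|exists t].
exists (inf S); split=> //; apply/cvgrPdist_lt => e e0.
have [_ [T T0 <-] hT] := inf_adherent e0 hS.
near=> t.
have Tt : T <= t by near: t; apply: nbhs_pinfty_ge; rewrite num_real.
have t0 : 0 <= t by apply: le_trans Tt.
rewrite distrC ger0_norm ?subr_ge0; last exact: mS.
by rewrite ltrBlDl; apply: le_lt_trans hT; exact: phid.
Unshelve. all: by end_near. Qed.

End RealLimits.

(** * Derivatives of inner products along a curve *)
Section DerivativesOfDot.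
Context (R : realType) (H : completeNormedModType R).
Context (dot : {dot H for (@idfun R)}).
Context (dot_norm : induces_norm dot).

Lemma is_derive_cvg (V : normedModType R) (f : R -> V) (t : R) (d : V) :
  is_derive t 1 f d <->
  h^-1 *: (f (h + t) - f t) @[h --> 0^'] --> d.
Proof.
have E : (fun h : R => h^-1 *: (f (h + t) - f t)) =
         (fun h : R => h^-1 *: ((f \o shift t) (h *: 1) - f t)).
  by apply/funext => h /=; rewrite [h *: 1]mulr1.
rewrite E; split=> [[df <-] //|fd].
by split; [exact: cvgP fd|exact: cvg_lim fd].
Qed.

Lemma is_derive_dotr (f : R -> H) (t : R) d v : is_derive t 1 f d ->
  is_derive t 1 (fun s => dot (f s) v) (dot d v).
Proof.
move=> /is_derive_cvg fd; apply/is_derive_cvg.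
rewrite (_ : (fun h => _) =
    fun h => dot (h^-1 *: (f (h + t) - f t)) v); last first.
  by apply/funext => h; rewrite dotZl dotDl dotNl.
by apply: cvg_dot => //; exact: cvg_cst.
Qed.

Lemma is_derive_sqr_dist (f : R -> H) (t : R) d c : is_derive t 1 f d ->
  is_derive t 1 (fun s => `|f s - c| ^+ 2) (2 * dot d (f t - c)).
Proof.
move=> /is_derive_cvg fd; apply/is_derive_cvg.
(* With [q] the difference quotient of [f], that of [|f - c|^2] is the product
   of [q h] with [f (h + t) + f t - 2 c = h q h + 2 (f t - c)]. *)
have -> : 2 * dot d (f t - c) = dot d (0 *: d + 2 *: (f t - c)).
  by rewrite scale0r add0r dotZr.
pose q h := h^-1 *: (f (h + t) - f t).
apply: (@cvg_trans _ (dot (q h) (h *: q h + 2 *: (f t - c)) @[h --> 0^'])).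
  apply: near_eq_cvg; near=> h.
  have h0 : h != 0 by near: h; exact: nbhs_dnbhs_neq.
  rewrite /q scalerA divff// scale1r dotZl.
  rewrite [RHS](_ : _ = h^-1 * (`|f (h + t) - c| ^+ 2 - `|f t - c| ^+ 2))//.
  rewrite -!(dotuu dot_norm) !dotE.
  rewrite (dotC dot (f t) (f (h + t))) (dotC dot c (f (h + t))).
  by rewrite (dotC dot c (f t)); ring.
apply: cvg_dot => //; apply: cvgD; last exact: cvg_cst.
by apply: cvgZ => //; exact: nbhs_dnbhs.
Unshelve. all: by end_near. Qed.

End DerivativesOfDot.

(** * The dynamical system *)
Section Dynamics.
Context (R : realType) (H : completeNormedModType R).
Context (dot : {dot H for (@idfun R)}).
Context (dot_norm : induces_norm dot).
Context (A B : operator H).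
Context (maxA : maximally_monotone dot A) (maxB : maximally_monotone dot B).

(** With [g = 0] this is the system [y] in [B x], [- y] in [A x] that encodes
    the zeros of [A + B]; along a trajectory, [g] is the velocity of [x + y]. *)
Definition perturbed_sol (x y g : H) := B x y /\ A (x + g) (- y - g).

(** The monotonicity inequalities are added; the perturbation enters with
    opposite signs in the two arguments of [A], which produces the square. *)
Lemma perturbed_sol_firm x1 y1 g1 x2 y2 g2 :
  perturbed_sol x1 y1 g1 -> perturbed_sol x2 y2 g2 ->
  dot (g1 - g2) ((x1 + y1) - (x2 + y2)) <= - `|g1 - g2| ^+ 2.
Proof.
move=> [B1 A1] [B2 A2]; rewrite -(dotuu dot_norm).
have -> : dot (g1 - g2) (x1 + y1 - (x2 + y2)) =
  - dot (g1 - g2) (g1 - g2) - dot (x1 - x2) (y1 - y2)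
  - dot (x1 + g1 - (x2 + g2)) (- y1 - g1 - (- y2 - g2)).
  rewrite !dotE (dotC dot x1 g1) (dotC dot x1 g2) (dotC dot x2 g1).
  by rewrite (dotC dot x2 g2); ring.
by have := maxB.1 _ _ _ _ B1 B2; have := maxA.1 _ _ _ _ A1 A2; lra.
Qed.

Lemma perturbed_sol_lipschitz x1 y1 g1 x2 y2 g2 :
  perturbed_sol x1 y1 g1 -> perturbed_sol x2 y2 g2 ->
  `|g1 - g2| <= `|(x1 + y1) - (x2 + y2)|.
Proof.
move=> k1 k2; have h := perturbed_sol_firm k1 k2.
have [->|g0] := eqVneq (g1 - g2) 0; first by rewrite normr0.
rewrite -(ler_pM2l (x := `|g1 - g2|)) ?normr_gt0// -expr2.
apply: le_trans (cauchy_schwarz dot_norm _ _).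
have := ler_norm (- dot (g1 - g2) (x1 + y1 - (x2 + y2))).
by rewrite normrN; lra.
Qed.

Lemma exact_solP x y : perturbed_sol x y 0 <-> B x y /\ A x (- y).
Proof. by rewrite /perturbed_sol addr0 subr0. Qed.

(** In the language of resolvents, [x] is the image of [x + y] under [J_B]. *)
Lemma exact_sol_sum_inj x1 y1 x2 y2 :
  perturbed_sol x1 y1 0 -> perturbed_sol x2 y2 0 ->
  x1 + y1 = x2 + y2 -> x1 = x2.
Proof.
move=> [B1 _] [B2 _] z12; have yE : y1 - y2 = - (x1 - x2).
  apply/eqP; rewrite eq_sym opprB subr_eq addrAC -subr_eq opprK.
  by rewrite addrC -z12 addrC.
have := maxB.1 _ _ _ _ B1 B2.
rewrite yE dotNr oppr_ge0 (dotuu dot_norm) => h; apply/eqP.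
by rewrite -subr_eq0 -normr_eq0 -sqrf_eq0 eq_le h sqr_ge0.
Qed.

(** Summed over [A] and [B], the monotonicity inequalities contain no product of
    two weakly convergent terms, as [<x, y>] cancels and [g] converges strongly.
    In the limit they give [key], a joint inequality for the two graphs.  It
    yields membership in both graphs: were [(xb, yb)] not in [B], some [(p, q)]
    in [B] would make the first term negative, hence the second positive for all
    [(r, s)] in [A], so that [(xb, - yb)] would be in [A]; taking it for
    [(r, s)] is a contradiction. *)
Lemma perturbed_sol_demiclosed (T : Type) (F : set_system T) (x y g : T -> H)
    (xb yb : H) (C : R) : ProperFilter F ->
  (\forall t \near F, perturbed_sol (x t) (y t) (g t)) ->
  (\forall t \near F, `|x t| <= C) -> (\forall t \near F, `|y t| <= C) ->
  (forall v, dot (x t) v @[t --> F] --> dot xb v) ->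
  (forall v, dot (y t) v @[t --> F] --> dot yb v) ->
  g t @[t --> F] --> 0 -> perturbed_sol xb yb 0.
Proof.
move=> FF hk xC yC xxb yyb g0.
have dot_bounded_g0 (f : T -> H) : (\forall t \near F, `|f t| <= C) ->
    dot (f t) (g t) @[t --> F] --> 0.
  move=> fC; apply/cvgr0Pnorm_le => e e0.
  have d0 : 0 < e / (`|C| + 1) by rewrite divr_gt0// ltr_pwDr.
  move/cvgr0Pnorm_le : g0 => /(_ _ d0); apply: filterS2 fC => t ftC.
  rewrite ler_pdivlMr ?ltr_pwDr// => h.
  apply: le_trans (cauchy_schwarz dot_norm _ _) (le_trans _ h).
  rewrite mulrC; apply: ler_wpM2l => //; apply: (le_trans ftC).
  by apply: le_trans (ler_norm C) _; rewrite lerDl.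
have key p q r s : B p q -> A r s ->
    0 <= dot (xb - p) (yb - q) + dot (xb - r) (- yb - s).
  move=> Bpq Ars.
  pose E t := - dot (x t) (q + s) + dot (y t) (r - p) + (dot p q + dot r s)
    + (dot (g t) (r - s) - dot (x t) (g t) - dot (y t) (g t) - dot (g t) (g t)).
  have E0 : \forall t \near F, 0 <= E t.
    apply: filterS hk => t [Bt At].
    have := maxB.1 _ _ _ _ Bt Bpq; have := maxA.1 _ _ _ _ At Ars.
    rewrite /E !dotE (dotC dot p (y t)) (dotC dot r (y t)) (dotC dot (g t) r).
    rewrite (dotC dot (g t) (y t)); lra.
  have gb : dot (g t) (g t) @[t --> F] --> dot 0 0 by exact: cvg_dot.
  have Elim : E t @[t --> F] --> - dot xb (q + s) + dot yb (r - p)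
      + (dot p q + dot r s) + (dot 0 (r - s) - 0 - 0 - dot 0 0).
    apply: cvgD; last first.
      apply: cvgB => //; apply: cvgB; last exact: dot_bounded_g0.
      apply: cvgB; last exact: dot_bounded_g0.
      by apply: cvg_dot => //; exact: cvg_cst.
    apply: cvgD; last exact: cvg_cst.
    by apply: cvgD => //; exact: cvgN.
  have := cvgr_to_ge Elim E0 => /(_ FF); rewrite !dotE.
  by rewrite (dotC dot p yb) (dotC dot r yb) (dotC dot xb yb); lra.
apply/exact_solP; suff Byb : B xb yb.
  split=> //; apply: max_monotone_mem maxA _ => r s Ars.
  by have := key _ _ _ _ Byb Ars; rewrite subrr dot0l add0r.
apply: max_monotone_mem maxB _ => p q Bpq; rewrite leNgt; apply/negP => neg.
have Axb : A xb (- yb).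
  apply: max_monotone_mem maxA _ => r s Ars.
  by have := key _ _ _ _ Bpq Ars; lra.
by have := key _ _ _ _ Bpq Axb; rewrite subrr dot0l; lra.
Qed.

Context (x y g : R -> H).
Let z t := x t + y t.
Context (sol_xyg : forall t : R, 0 <= t -> perturbed_sol (x t) (y t) (g t)).
Context (ac_z : locally_absolutely_continuous z).
Context (dz : {ae lebesgue_measure, forall t : R, 0 <= t ->
  is_derive t 1 z (g t)}).

(** A function of time dominated by the motion of [z] inherits absolute
    continuity from it, so that a bound on its formal derivative [phi'] can be
    integrated. *)
Lemma ac_curve_le (phi phi' : R -> R) (K a b c : R) : 0 <= a -> a <= b ->
  (forall s t, a <= s <= b -> a <= t <= b ->
     `|phi t - phi s| <= K * `|z t - z s|) ->
  (forall t : R, is_derive t 1 z (g t) -> is_derive t 1 phi (phi' t)) ->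
  (forall t, a <= t <= b -> phi' t <= c) ->
  phi b - phi a <= c * (b - a).
Proof.
move=> a0 ab phiK dphi phi'c; apply: ac_derive_le => //.
  apply: ac_comp phiK _; have b1 : 0 < b + 1 by lra.
  by apply: ac_subitv (ac_z b1) => //; lra.
have aeF := ae_filter_ringOfSetsType (@lebesgue_measure R).
apply: (@filterS _ _ aeF _ _ _ dz) => t dzt tab.
exists (phi' t); last exact: phi'c.
by apply/dphi/dzt; move: tab => /andP[]; lra.
Qed.

Section Fejer.
Context (p q : H).
Context (pq : perturbed_sol p q 0).

(** The derivative of [|z - (p + q)|^2] is [2 <g, z - (p + q)>], which is at
    most [- 2 |g|^2] by comparison of the trajectory with [(p, q)]. *)
Lemma fejer (m s t : R) : 0 <= m -> 0 <= s -> s <= t ->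
  (forall r, s <= r <= t -> m <= `|g r|) ->
  `|z t - (p + q)| ^+ 2 - `|z s - (p + q)| ^+ 2 <= - (2 * m ^+ 2) * (t - s).
Proof.
move=> m0 s0 st mg.
have t1 : 0 < t + 1 by lra.
have [|C hC] := ac_bounded _ (ac_z t1); first by lra.
pose phi' r := 2 * dot (g r) (z r - (p + q)).
apply: (ac_curve_le (phi := fun r => `|z r - (p + q)| ^+ 2) (phi' := phi')
  (K := 2 * (C + `|p + q|))) => //.
- move=> a b sat sbt.
  rewrite subr_sqr normrM mulrC; apply: ler_pM => //.
    rewrite ger0_norm ?addr_ge0//.
    have zC r : s <= r <= t -> `|z r - (p + q)| <= C + `|p + q|.
      move=> /andP[sr rt]; apply: le_trans (ler_normB _ _) _.
      by rewrite lerD2r; apply: hC; apply/andP; split; lra.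
    by rewrite mulr_natl mulr2n; apply: lerD; exact: zC.
  apply: le_trans (ler_dist_dist _ _) _.
  by rewrite opprB addrA subrK.
- by move=> r; exact: is_derive_sqr_dist.
- move=> r /andP[sr rt].
  have := perturbed_sol_firm (sol_xyg (le_trans s0 sr)) pq.
  rewrite subr0 -/(z r) => h.
  have : m ^+ 2 <= `|g r| ^+ 2.
    by rewrite ler_sqr ?nnegrE// mg// sr.
  by rewrite /phi'; lra.
Qed.

Lemma fejer_decr s t : 0 <= s -> s <= t ->
  `|z t - (p + q)| ^+ 2 <= `|z s - (p + q)| ^+ 2.
Proof.
move=> s0 st; have := fejer (lexx 0) s0 st (fun=> fun=> normr_ge0 _).
by rewrite expr0n /= mulr0 oppr0 mul0r subr_le0.
Qed.

Lemma fejer_dist t : 0 <= t -> `|z t - (p + q)| <= `|z 0 - (p + q)|.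
Proof. by move=> t0; rewrite -ler_sqr ?nnegrE//; exact: fejer_decr. Qed.

Let C := `|z 0 - (p + q)|.

Lemma velocity_bounded t : 0 <= t -> `|g t| <= C.
Proof.
move=> t0; apply: le_trans (fejer_dist t0).
by have := perturbed_sol_lipschitz (sol_xyg t0) pq; rewrite subr0.
Qed.

(** Integrate the scalar function [<z, v>] in the direction [v = z t - z s]. *)
Lemma curve_lipschitz s t : 0 <= s -> s <= t -> `|z t - z s| <= C * (t - s).
Proof.
move=> s0 st; have [->|zst] := eqVneq (z t - z s) 0.
  by rewrite normr0; apply: mulr_ge0; [exact: normr_ge0|rewrite subr_ge0].
have : dot (z t) (z t - z s) - dot (z s) (z t - z s) <=
    C * `|z t - z s| * (t - s).
  apply: (ac_curve_le (phi := fun r => dot (z r) (z t - z s))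
     (K := `|z t - z s|)
     (phi' := fun r => dot (g r) (z t - z s))) => //.
  - move=> a b _ _; rewrite -dotNl -dotDl mulrC; exact: cauchy_schwarz.
  - by move=> r; exact: is_derive_dotr.
  - move=> r /andP[sr _]; apply: le_trans (ler_norm _) _.
    apply: le_trans (cauchy_schwarz dot_norm _ _) _.
    by apply: ler_wpM2r => //; apply: velocity_bounded; exact: le_trans sr.
rewrite -dotNl -dotDl (dotuu dot_norm) expr2 mulrAC ler_pM2r//.
by rewrite normr_gt0.
Qed.

Lemma dist_cvg : exists m, (forall t, 0 <= t -> m <= `|z t - (p + q)| ^+ 2) /\
  `|z t - (p + q)| ^+ 2 @[t --> +oo] --> m.
Proof.
apply: (nonincreasing_cvg_pinfty (c := 0)) => [|t _]; first exact: fejer_decr.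
exact: sqr_ge0.
Qed.

(** The velocity is Lipschitz with constant [C], so where its norm is at least
    [e] it stays above [e / 2] for the duration [r]; over this time the squared
    distance to [p + q] loses [eta], which is impossible once it is within [eta]
    of its limit. *)
Lemma velocity_cvg0 : g t @[t --> +oo] --> 0.
Proof.
have C0 : 0 <= C by exact: normr_ge0.
have [m [mle cvgm]] := dist_cvg.
apply/cvgr0Pnorm_lt => e e0.
pose r := e / (2 * (C + 1)).
have r0 : 0 < r by rewrite divr_gt0// mulr_gt0//; lra.
have Cr : C * r <= e / 2.
  rewrite /r mulrA ler_pdivrMr; last by rewrite mulr_gt0//; lra.
  by have := mulr_ge0 C0 (ltW e0); lra.
pose eta := e ^+ 2 / 2 * r.
have eta0 : 0 < eta by rewrite mulr_gt0// divr_gt0// exprn_gt0.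
move/cvgrPdist_lt : cvgm => /(_ _ eta0) near_m.
near=> t.
have t0 : 0 <= t by near: t; apply: nbhs_pinfty_ge; rewrite num_real.
have mt : `|z t - (p + q)| ^+ 2 < m + eta.
  have : `|m - `|z t - (p + q)| ^+ 2| < eta by near: t.
  by rewrite ltr_norml => /andP[h _]; lra.
rewrite ltNge; apply/negP => eg.
have e20 : 0 <= e / 2 by lra.
have tr : t <= t + r by lra.
have := fejer e20 t0 tr; have := mle (t + r) (le_trans t0 tr).
have rE : t + r - t = r by rewrite addrC addKr.
rewrite rE => h1 h2.
suff /h2 : forall s, t <= s <= t + r -> e / 2 <= `|g s|.
  have -> : - (2 * (e / 2) ^+ 2) * r = - eta by rewrite /eta; field.
  by lra.
move=> s /andP[ts str].
have s0 : 0 <= s := le_trans t0 ts.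
have k := perturbed_sol_lipschitz (sol_xyg s0) (sol_xyg t0).
have l := curve_lipschitz t0 ts.
have Cs : C * (s - t) <= C * r by apply: ler_wpM2l => //; lra.
have := ler_distD (g s) (g t) 0; rewrite !subr0 distrC.
by rewrite -/(z s) -/(z t) in k; lra.
Unshelve. all: by end_near. Qed.

(** The cross term in the square of [z - (p + q) = (x - p) + (y - q)] is
    nonnegative by monotonicity of [B]. *)
Lemma components_bounded t : 0 <= t ->
  `|x t - p| <= C /\ `|y t - q| <= C.
Proof.
move=> t0; have zC := fejer_dist t0.
have [Bt _] := sol_xyg t0; have [Bpq _] := pq.
have := maxB.1 _ _ _ _ Bt Bpq => mono.
have : `|z t - (p + q)| ^+ 2 =
    `|x t - p| ^+ 2 + `|y t - q| ^+ 2 + 2 * dot (x t - p) (y t - q).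
  have -> : z t - (p + q) = (x t - p) + (y t - q) by rewrite opprD addrACA.
  rewrite -!(dotuu dot_norm); move: (x t - p) (y t - q) => a b.
  by rewrite !dotE (dotC dot b a); ring.
have : `|z t - (p + q)| ^+ 2 <= C ^+ 2 by rewrite ler_sqr ?nnegrE// normr_ge0.
have := sqr_ge0 `|x t - p|; have := sqr_ge0 `|y t - q| => h1 h2 h3 h4.
by split; rewrite -ler_sqr ?nnegrE// ?normr_ge0//; lra.
Qed.

End Fejer.

(** Weak limits along ultrafilters exist by boundedness and are exact solutions
    because the velocity tends to [0]; Opial's argument shows that they do not
    depend on the ultrafilter. *)
Lemma weak_cvg_solution : (exists p q, perturbed_sol p q 0) ->
  exists xb yb, [/\ perturbed_sol xb yb 0, weakly_converges dot x xb &
    weakly_converges dot y yb].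
Proof.
move=> [p [q pq]].
have near0 : \forall t \near +oo, 0 <= t :> R.
  by apply: nbhs_pinfty_ge; rewrite num_real.
pose C := `|z 0 - (p + q)| + `|p| + `|q|.
have xC : \forall t \near +oo, `|x t| <= C.
  apply: filterS near0 => t /(components_bounded pq)[h _].
  have := ler_normD (x t - p) p; rewrite subrK /C.
  by have := normr_ge0 q; lra.
have yC : \forall t \near +oo, `|y t| <= C.
  apply: filterS near0 => t /(components_bounded pq)[_ h].
  have := ler_normD (y t - q) q; rewrite subrK /C.
  by have := normr_ge0 p; lra.
have cluster_sol (U : set_system R) : UltraFilter U -> +oo `<=` U ->
    exists xb yb, [/\ perturbed_sol xb yb 0,
      forall v, dot (x t) v @[t --> U] --> dot xb v &
      forall v, dot (y t) v @[t --> U] --> dot yb v].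
  move=> UU oU.
  have [xb hx] := bounded_weak_ultra_cvg dot_norm UU (oU _ xC).
  have [yb hy] := bounded_weak_ultra_cvg dot_norm UU (oU _ yC).
  exists xb, yb; split=> //.
  have hk : \forall t \near U, perturbed_sol (x t) (y t) (g t).
    by apply: filterS (oU _ near0) => t; exact: sol_xyg.
  have hg : g t @[t --> U] --> 0 by move=> S /(velocity_cvg0 pq) /oU.
  exact: (perturbed_sol_demiclosed _ hk (oU _ xC) (oU _ yC) hx hy hg).
have [U0 [UU0 oU0]] := ultraFilterLemma (@proper_pinfty_nbhs R).
have [xb [yb [sol0 x0 y0]]] := cluster_sol _ UU0 oU0.
exists xb, yb.
have same (U : set_system R) : UltraFilter U -> +oo `<=` U ->
    forall v, dot (x t) v @[t --> U] --> dot xb v /\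
              dot (y t) v @[t --> U] --> dot yb v.
  move=> UU oU; have [x1 [y1 [sol1 hx hy]]] := cluster_sol _ UU oU.
  have [m0 [_ c0]] := dist_cvg sol0; have [m1 [_ c1]] := dist_cvg sol1.
  (* The squared distances of [z] to both sums converge; their difference is
     affine in [<z, w>], which therefore has the same limit along [U0] and
     [U]. *)
  set w := (xb + yb) - (x1 + y1).
  have cw : dot (z t) w @[t --> +oo] -->
     (m1 - m0 + (`|xb + yb| ^+ 2 - `|x1 + y1| ^+ 2)) / 2.
    rewrite (_ : (fun t => _) = fun t => (`|z t - (x1 + y1)| ^+ 2 -
       `|z t - (xb + yb)| ^+ 2 + (`|xb + yb| ^+ 2 - `|x1 + y1| ^+ 2)) / 2).
      apply: cvgM; last exact: cvg_cst.
      by apply: cvgD; [exact: cvgB|exact: cvg_cst].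
    apply/funext => t; rewrite -!(dotuu dot_norm) /w.
    move: (z t) (xb + yb) (x1 + y1) => a b c; rewrite !dotE.
    by rewrite (dotC dot b a) (dotC dot c a); field.
  have zU0 : dot (z t) w @[t --> U0] --> dot (xb + yb) w.
    by rewrite dotDl; under eq_fun do rewrite dotDl; exact: cvgD.
  have zU : dot (z t) w @[t --> U] --> dot (x1 + y1) w.
    by rewrite dotDl; under eq_fun do rewrite dotDl; exact: cvgD.
  have w0 : dot w w = 0.
    rewrite {1}/w dotDl dotNl; apply/eqP; rewrite subr_eq0; apply/eqP.
    have e0 := @cvg_unique R (@norm_hausdorff _ _) _ _ _ _ zU0
      (cvg_trans (cvg_app _ oU0) cw).
    have e1 := @cvg_unique R (@norm_hausdorff _ _) _ _ _ _ zU
      (cvg_trans (cvg_app _ oU) cw).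
    by rewrite e0 e1.
  have zz : xb + yb = x1 + y1.
    by apply/eqP; rewrite -subr_eq0 -normr_eq0 -sqrf_eq0 -(dotuu dot_norm) w0.
  have xx := exact_sol_sum_inj sol0 sol1 zz.
  by move: zz; rewrite xx => /addrI -> v; split.
by split=> // v; apply: cvg_ultra => U UU oU; have [] := same U UU oU v.
Qed.

End Dynamics.

Theorem theorem2 (R : realType) (H : completeNormedModType R)
    (dot : {dot H for (@idfun R)}) (dot_norm : induces_norm dot)
    (A B : operator H)
    (maxA : maximally_monotone dot A) (maxB : maximally_monotone dot B)
    (zerAB : zer (op_add A B) !=set0)
    (lambda : R) (lambda_gt0 : 0 < lambda) (x0 : H) (x y : R -> H)
    (xy_traj : trajectory A B lambda x0 x y) :
  exists xbar ybar : H,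
    (weakly_converges dot x xbar /\ zer (op_add A B) xbar) /\
    (weakly_converges dot y ybar /\
     (op_scale lambda B xbar `&` [set - u | u in op_scale lambda A xbar]) ybar).
Proof.
have maxA' := max_monotone_scale lambda_gt0 maxA.
have maxB' := max_monotone_scale lambda_gt0 maxB.
case: xy_traj => acx acy dxy hB _.
pose g t := resolvent (op_scale lambda A) (x t - y t) - x t.
have sol_xyg (t : R) : 0 <= t ->
    perturbed_sol (op_scale lambda A) (op_scale lambda B) (x t) (y t) (g t).
  move=> t0; split; first exact: hB.
  have -> : x t + g t = resolvent (op_scale lambda A) (x t - y t).
    by rewrite addrC subrK.
  have -> : - y t - g t = x t - y t - resolvent (op_scale lambda A) (x t - y t).
    by rewrite opprB addrA [- y t + x t]addrC.
  exact: (resolventP dot_norm).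
have acz : locally_absolutely_continuous (fun t => x t + y t).
  by move=> T T0; apply: ac_add; [exact: acx|exact: acy].
have dz : {ae lebesgue_measure, forall t : R, 0 <= t ->
    is_derive t 1 (fun t => x t + y t) (g t)}.
  have aeF := ae_filter_ringOfSetsType (@lebesgue_measure R).
  apply: (@filterS _ _ aeF _ _ _ dxy) => t h /h[dx dy E].
  have -> : g t = 'D_1 x t + 'D_1 y t.
    by apply/eqP; rewrite /g subr_eq addrAC E subrK.
  by apply: is_deriveD; apply/derivableP.
have [|xb [yb [[Byb Ayb] xcvg ycvg]]] :=
    weak_cvg_solution dot_norm maxA' maxB' sol_xyg acz dz.
  have [p [a Apa [b Bpb ab]]] := zerAB.
  exists p, (lambda *: b); apply/exact_solP.
  split; first by exists b.
  exists a => //; rewrite -scalerN; congr (_ *: _).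
  by apply/eqP; rewrite -addr_eq0; apply/eqP.
rewrite addr0 subr0 in Ayb.
exists xb, yb; split; split=> //.
  have [[a Aa aE] [b Bb bE]] := (Ayb, Byb).
  exists a => //; exists b => //; apply/eqP.
  have /eqP : lambda *: (a + b) = 0 by rewrite scalerDr aE bE addNr.
  by rewrite scaler_eq0 gt_eqF.
by split=> //; exists (- yb) => //; rewrite opprK.
Qed.
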